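(* There exists $m\in(1,2]$ such that, with $\beta=\mathcal{G}(\{0,1,m\})$: (i) $\mathcal{U}_\beta(\{0,1,m\})$ contains an element other than $\overline0$ and $\overline m$; and (ii) there exists a real number $x$ having precisely two $\beta$-expansions over the alphabet $\{0,1,m\}$.
   Context: For an alphabet (finite set of reals) $A$ with minimum $a_0$ and maximum $a_d$, and $\beta>1$: a $\beta$-expansion of $x$ over $A$ is a sequence $(u_k)_{k\ge1}\in A^{\mathbb{N}}$ with $x=\sum_{k\ge1}u_k\beta^{-k}$; $\mathcal{U}_\beta(A)$ is the set of sequences $(u_k)\in A^{\mathbb{N}}$ such that $\sum_k u_k\beta^{-k}$ has a unique $\beta$-expansion; the generalised golden ratio $\mathcal{G}(A)>1$ is the unique number such that $\mathcal{U}_\beta(A)=\{\overline{a_0},\overline{a_d}\}$ (constant sequences) for $\beta\in(1,\mathcal{G}(A))$ and $\mathcal{U}_\beta(A)$ contains another element for all $\beta>\mathcal{G}(A)$. *)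

(* Defs.v *)
From Stdlib Require Import Reals List Lra.
From Coquelicot Require Import Coquelicot.

Open Scope R_scope.

(** An alphabet is a finite set of reals, given by a list; only membership
    matters, so order and repetitions are irrelevant. *)
Definition seq_over (A : list R) (u : nat -> R) : Prop :=
  forall k, In (u k) A.

(** Sequences are indexed from 0: [u k] is the digit usually written
    u_(k+1), so its weight is [/ beta ^ (k + 1)]. *)
Definition is_expansion (beta : R) (A : list R) (u : nat -> R) (x : R) : Prop :=
  seq_over A u /\ is_series (fun k => u k / beta ^ S k) x.

(** [u] belongs to U_beta(A): its value x has [u] as its only expansion. *)
Definition in_U (beta : R) (A : list R) (u : nat -> R) : Prop :=
  exists x, is_expansion beta A u x /\
    forall v, is_expansion beta A v x -> v = u.

Definition is_minimum (A : list R) (a : R) : Prop :=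
  In a A /\ forall b, In b A -> a <= b.

Definition is_maximum (A : list R) (a : R) : Prop :=
  In a A /\ forall b, In b A -> b <= a.

Definition const_seq (a : R) : nat -> R := fun _ => a.

(** [G] is the generalised golden ratio of [A].  It is a relation rather than
    a function so that asserting it includes the existence of the golden
    ratio; uniqueness is [golden_ratio_unique]. *)
Definition is_golden_ratio (A : list R) (G : R) : Prop :=
  1 < G /\
  exists a0 ad, is_minimum A a0 /\ is_maximum A ad /\
    (forall beta, 1 < beta < G ->
       forall u, in_U beta A u <-> (u = const_seq a0 \/ u = const_seq ad)) /\
    (forall beta, G < beta ->
       exists u, in_U beta A u /\ u <> const_seq a0 /\ u <> const_seq ad).

Lemma golden_ratio_unique (A : list R) (G G' : R) :
  is_golden_ratio A G -> is_golden_ratio A G' -> G = G'.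
Proof.
assert (key : forall H H', is_golden_ratio A H -> is_golden_ratio A H' ->
          ~ H < H').
{ intros H H' [H1 [a [d [[ai am] [[di dm] [_ Habove]]]]]]
              [H1' [a' [d' [[ai' am'] [[di' dm'] [Hbelow _]]]]]] Hlt.
  assert (Ea : a = a') by (apply Rle_antisym; auto).
  assert (Ed : d = d') by (apply Rle_antisym; auto).
  subst a' d'.
  destruct (Habove ((H + H') / 2)) as [u [Hu [ua ud]]]; [lra|].
  apply Hbelow in Hu; [|lra].
  destruct Hu; contradiction. }
intros HG HG'.
destruct (Rtotal_order G G') as [h | [h | h]].
- exfalso; exact (key G G' HG HG' h).
- exact h.
- exfalso; exact (key G' G HG' HG h).
Qed.

(* Main.v *)
(** Let s be the Fibonacci word, the fixed point of 0 -> 01, 1 -> 0.  All its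
    tails lie strictly between 0s and 1s, and conversely a 0-1 word whose tails
    lie weakly between 0s and 1s contains 1 followed by arbitrarily long
    prefixes of s: the substitution reverses the lexicographic order, so such a
    word is, up to its first letter, the image of a word of the same kind.
    Choose P > 2 such that s has value P(P-2) in base P, and
    m = (P-1)^2, so that P = 1 + sqrt m.  Then s has value m-1 and 0s has value
    m/(P-1) - 1, which are exactly the bounds that uniqueness imposes on the
    tail after a digit 1: the strict inequalities for s put s in U_beta for
    all beta >= P.  For beta < P, a nonconstant sequence of U_beta is, up to a
    prefix, a 0-1 word with tails between 0s and 1s; by approximation s would
    have value at most m-1 in base beta, which is smaller than its value.  As s
    has value m-1 in base P, the sequences 1s and m000... have the same value,
    and no other expansion shares it. *)
Require Import Defs.
From Stdlib Require Import Reals List.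
From Coquelicot Require Import Coquelicot.
From Stdlib Require Import Ranalysis5 Arith Lra Lia Classical.
From Stdlib Require Import FunctionalExtensionality.
Import ListNotations.
Open Scope R_scope.

(** * The Fibonacci word *)

Definition shift {T : Type} (k : nat) (x : nat -> T) : nat -> T :=
  fun n => x (k + n)%nat.

Definition scons {T : Type} (a : T) (x : nat -> T) : nat -> T :=
  fun n => match n with O => a | S k => x k end.

Lemma shift0 {T : Type} (x : nat -> T) : shift 0 x = x.
Proof. reflexivity. Qed.

Lemma shift_shift {T : Type} j k (x : nat -> T) :
  shift j (shift k x) = shift (k + j) x.
Proof. extensionality n; unfold shift; f_equal; lia. Qed.

Lemma scons_shift {T : Type} k (x : nat -> T) :
  shift k x = scons (x k) (shift (S k) x).
Proof.
extensionality n; destruct n; unfold shift; simpl; f_equal; lia.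
Qed.

Lemma shift1_scons {T : Type} (a : T) x : shift 1 (scons a x) = x.
Proof. reflexivity. Qed.

(** * Prefixes and lexicographic order *)

Definition agree {T : Type} (n : nat) (x y : nat -> T) : Prop :=
  forall i, (i < n)%nat -> x i = y i.

Lemma agree_scons {T : Type} n (a : T) x y :
  agree n x y -> agree (S n) (scons a x) (scons a y).
Proof. intros H [|i] Hi; simpl; [reflexivity | apply H; lia]. Qed.

Definition lexlt (x y : nat -> bool) : Prop :=
  exists n, agree n x y /\ x n = false /\ y n = true.

Lemma lexlt_scons a x y : lexlt (scons a x) (scons a y) <-> lexlt x y.
Proof.
split.
- intros [[|n] [H [Hx Hy]]]; simpl in Hx, Hy; [congruence|].
  exists n; repeat split; auto.
  intros i Hi; apply (H (S i)); lia.
- intros [n [H [Hx Hy]]]; exists (S n); repeat split; auto.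
  now apply agree_scons.
Qed.

Lemma lexlt_false_true x y : lexlt (scons false x) (scons true y).
Proof. exists 0%nat; repeat split; intros i Hi; lia. Qed.

Lemma not_lexlt_true_false x y : ~ lexlt (scons true x) (scons false y).
Proof.
intros [[|n] [H [Hx Hy]]]; simpl in *; [discriminate|].
specialize (H 0%nat); simpl in H; now discriminate H; lia.
Qed.

(** The boolean [true] stands for the digit 1. *)
Fixpoint theta (x : nat -> bool) (n : nat) : bool :=
  match n with
  | O => false
  | S n1 =>
      if x O then theta (shift 1 x) n1
      else match n1 with O => true | S n2 => theta (shift 1 x) n2 end
  end.

Lemma theta_true x : theta (scons true x) = scons false (theta x).
Proof. extensionality n; destruct n; reflexivity. Qed.

Lemma theta_false x :
  theta (scons false x) = scons false (scons true (theta x)).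
Proof. extensionality n; destruct n as [|[|n]]; reflexivity. Qed.

Lemma theta_head x : theta x = scons false (shift 1 (theta x)).
Proof. exact (scons_shift 0 (theta x)). Qed.

(** Images of letters are nonempty and all begin with 0, so the letter after the images of the
    common prefix is known too. This gain makes iterates of [theta] converge. *)
Lemma theta_agree n x y : agree n x y -> agree (S n) (theta x) (theta y).
Proof.
revert x y; induction n as [|n IH]; intros x y H.
- intros [|i] Hi; [reflexivity | lia].
- rewrite <- (shift0 x), <- (shift0 y), (scons_shift 0 x), (scons_shift 0 y).
  rewrite <- (H 0%nat) by lia.
  assert (H1 : agree n (shift 1 x) (shift 1 y)).
  { intros i Hi; apply (H (S i)); lia. }
  apply IH in H1.
  destruct (x 0%nat).
  + rewrite !theta_true; now apply agree_scons.
  + rewrite !theta_false; do 2 apply agree_scons.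
    intros i Hi; apply H1; lia.
Qed.

(** At the first difference, 0 gives 01, while 1 gives 0 followed by the 0 that opens every image:
    00 lies below 01. *)
Lemma theta_lexlt x y : lexlt x y -> lexlt (theta y) (theta x).
Proof.
intros [n H]; revert x y H; induction n as [|n IH]; intros x y [H [Hx Hy]];
  rewrite <- (shift0 x), <- (shift0 y), (scons_shift 0 x), (scons_shift 0 y).
- rewrite Hx, Hy, theta_true, theta_false, (theta_head (shift 1 y)).
  apply lexlt_scons, lexlt_false_true.
- assert (H1 : lexlt (theta (shift 1 y)) (theta (shift 1 x))).
  { apply IH; repeat split; auto.
    intros i Hi; apply (H (S i)); lia. }
  rewrite <- (H 0%nat) by lia.
  destruct (x 0%nat); rewrite ?theta_true, ?theta_false; now rewrite !lexlt_scons.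
Qed.

(** A tail of an image starts at a block boundary or at the 1 of a block 01. The bounds on [j] serve
    the strong induction in [fib_shift_bounds]. *)
Lemma theta_shift k x :
  (exists j, (j <= k)%nat /\ shift k (theta x) = theta (shift j x)) \/
  (exists j, (j < k)%nat /\ x j = false /\
     shift k (theta x) = scons true (theta (shift (S j) x))).
Proof.
revert x; induction k as [k IH] using (well_founded_ind Nat.lt_wf_0); intro x.
destruct k as [|k]; [left; exists 0%nat; split; [lia | reflexivity]|].
assert (push : forall y i, (i <= k)%nat ->
    y = theta (shift 1 x) ->
    (exists j, (j <= S k)%nat /\ shift i y = theta (shift j x)) \/
    (exists j, (j < S k)%nat /\ x j = false /\
       shift i y = scons true (theta (shift (S j) x)))).
{ intros y i Hi ->.
  destruct (IH i ltac:(lia) (shift 1 x)) as [[j [Hj E]]|[j [Hj [Hx E]]]].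
  - left; exists (S j); split; [lia|]; rewrite E, shift_shift; reflexivity.
  - right; exists (S j); repeat split; [lia| exact Hx |].
    rewrite E, shift_shift; reflexivity. }
destruct (x 0%nat) eqn:H0.
- replace (shift (S k) (theta x)) with (shift k (theta (shift 1 x))).
  { apply push; auto. }
  change (theta x) with (theta (shift 0 x)).
  rewrite (scons_shift 0 x), H0, theta_true; reflexivity.
- destruct k as [|k].
  + right; exists 0%nat; repeat split; [lia | exact H0 |].
    change (theta x) with (theta (shift 0 x)).
    rewrite (scons_shift 0 x) at 1; rewrite H0, theta_false; reflexivity.
  + replace (shift (S (S k)) (theta x)) with (shift k (theta (shift 1 x))).
    { apply push; auto. }
    change (theta x) with (theta (shift 0 x)).
    rewrite (scons_shift 0 x), H0, theta_false; reflexivity.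
Qed.

Lemma theta_block j x : exists k, shift k (theta x) = theta (shift j x).
Proof.
induction j as [|j [k IH]]; [exists 0%nat; reflexivity|].
rewrite (scons_shift j x) in IH.
destruct (x j).
- exists (k + 1)%nat; rewrite <- shift_shift, IH, theta_true; reflexivity.
- exists (k + 2)%nat; rewrite <- shift_shift, IH, theta_false; reflexivity.
Qed.

(** Inverts [theta] on words that begin with 0 and avoid 11: they split into blocks 01 and 0, told
    apart by the letter after the 0. *)
Fixpoint desubst (x : nat -> bool) (n : nat) : bool :=
  match n with
  | O => negb (x 1%nat)
  | S k => if x 1%nat then desubst (shift 2 x) k else desubst (shift 1 x) k
  end.

Lemma theta_desubst x :
  x 0%nat = false -> (forall k, x k = true -> x (S k) = false) ->
  theta (desubst x) = x.
Proof.
intros H0 H; extensionality n; revert x H0 H.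
induction n as [n IH] using (well_founded_ind Nat.lt_wf_0); intros x H0 H.
destruct n as [|n]; [now rewrite H0|].
simpl; destruct (x 1%nat) eqn:H1; simpl.
- destruct n as [|n]; [now rewrite H1|].
  replace (shift 1 (desubst x)) with (desubst (shift 2 x)).
  + rewrite IH; [reflexivity | lia | now apply H |].
    intros k Hk; now apply H.
  + extensionality i; unfold shift at 2; simpl; now rewrite H1.
- replace (shift 1 (desubst x)) with (desubst (shift 1 x)).
  + rewrite IH; [reflexivity | lia | exact H1 |].
    intros k Hk; now apply H.
  + extensionality i; unfold shift at 2; simpl; now rewrite H1.
Qed.

(** Read off diagonally: [n] iterations settle the first [n] letters, whatever the seed, so the
    letter at index [n] takes [S n]. *)
Definition fib (n : nat) : bool :=
  Nat.iter (S n) theta (fun _ => false) n.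

Lemma iter_theta_agree n x y :
  agree n (Nat.iter n theta x) (Nat.iter n theta y).
Proof.
induction n as [|n IH]; [intros i Hi; lia | now apply theta_agree].
Qed.

Lemma fib_agree n : agree n fib (Nat.iter n theta (fun _ => false)).
Proof.
intros i Hi; unfold fib.
replace n with (S i + (n - S i))%nat by lia.
rewrite Nat.iter_add; apply iter_theta_agree; lia.
Qed.

Lemma theta_fib : theta fib = fib.
Proof.
extensionality n.
transitivity (Nat.iter (S n) theta (fun _ => false) n); [|reflexivity].
apply (theta_agree n _ _ (fib_agree n)); lia.
Qed.

(** A tail of s is the image of a tail, or 1 followed by such an image. Where first letters do not
    decide, order reversal derives each bound from the opposite one. *)
Lemma fib_shift_bounds k :
  lexlt (scons false fib) (shift k fib) /\ lexlt (shift k fib) (scons true fib).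
Proof.
induction k as [k IH] using (well_founded_ind Nat.lt_wf_0).
destruct k as [|k].
{ split.
  - exists 1%nat; repeat split.
    intros i Hi; replace i with 0%nat by lia; reflexivity.
  - rewrite (scons_shift 0 fib); apply lexlt_false_true. }
set (K := S k) in *.
(* The upper bound comes first: the lower bound at [K] may call for it at [K] itself. *)
assert (up : lexlt (shift K fib) (scons true fib)).
{ destruct (theta_shift K fib) as [[j [Hj E]]|[j [Hj [Hx E]]]];
    rewrite theta_fib in E; rewrite E.
  - rewrite theta_head; apply lexlt_false_true.
  - destruct (IH j Hj) as [lo _].
    rewrite (scons_shift j), Hx, lexlt_scons in lo.
    apply theta_lexlt in lo; rewrite theta_fib in lo.
    now apply lexlt_scons. }
split; [|exact up].
destruct (theta_shift K fib) as [[j [Hj E]]|[j [Hj [Hx E]]]];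
  rewrite theta_fib in E; rewrite E.
- assert (up' : lexlt (shift j fib) (scons true fib)).
  { destruct (Nat.eq_dec j K) as [->|Hne]; [exact up | apply IH; lia]. }
  apply theta_lexlt in up'; now rewrite theta_true, theta_fib in up'.
- apply lexlt_false_true.
Qed.

(** * Words with all tails between 0s and 1s *)

Definition fib_bounded (x : nat -> bool) : Prop :=
  forall k, ~ lexlt (shift k x) (scons false fib) /\
            ~ lexlt (scons true fib) (shift k x).

Lemma fib_bounded_shift k x : fib_bounded x -> fib_bounded (shift k x).
Proof. intros H j; rewrite shift_shift; apply H. Qed.

(** As s begins with 0, a tail starting with 11 would exceed 1s. *)
Lemma fib_bounded_isolated x :
  fib_bounded x -> forall k, x k = true -> x (S k) = false.
Proof.
intros H k Hk; destruct (x (S k)) eqn:H1; [exfalso | reflexivity].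
destruct (H k) as [_ []]; exists 1%nat; repeat split.
- intros i Hi; replace i with 0%nat by lia.
  unfold shift; rewrite Nat.add_0_r, Hk; reflexivity.
- unfold shift; now rewrite Nat.add_1_r.
Qed.

(** Violations pass to the image with the bounds exchanged: a tail above 1s maps below 0s, and the
    image of a tail below 0s, without its initial 0, is above 1s. *)
Lemma fib_bounded_theta x : fib_bounded (theta x) -> fib_bounded x.
Proof.
intros H j; split; intro L.
- destruct (theta_block j x) as [k E].
  rewrite (scons_shift j) in L, E.
  destruct (x j); [now apply not_lexlt_true_false in L|].
  rewrite lexlt_scons in L; apply theta_lexlt in L; rewrite theta_fib in L.
  rewrite theta_false in E.
  destruct (H (k + 1)%nat) as [_ []].
  rewrite <- shift_shift, E; now apply lexlt_scons.
- apply theta_lexlt in L; rewrite theta_true, theta_fib in L.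
  destruct (theta_block j x) as [k E]; rewrite <- E in L.
  now apply H in L.
Qed.

(** The word 0s begins with 001, so a word starting with 000 lies below it. *)
Lemma fib_bounded_has_true x : fib_bounded x -> exists k, x k = true.
Proof.
intro H.
destruct (x 0%nat) eqn:H0; [now exists 0%nat|].
destruct (x 1%nat) eqn:H1; [now exists 1%nat|].
destruct (x 2%nat) eqn:H2; [now exists 2%nat|].
exfalso; apply (proj1 (H 0%nat)); exists 2%nat; repeat split; auto.
intros [|[|i]] Hi; simpl; [exact H0 | exact H1 | lia].
Qed.

(** Both digits have to be carried through the induction, because [theta]
    turns occurrences of [0t] into [1 theta(t)] and those of [1t] into
    [0 theta(t)]. *)
Lemma fib_bounded_prefix n x (b : bool) :
  fib_bounded x -> exists k, x k = b /\ agree n fib (shift (S k) x).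
Proof.
revert x b; induction n as [|n IH]; intros x b H.
- destruct (fib_bounded_has_true x H) as [k Hk].
  destruct b; [exists k | exists (S k)]; (split; [|intros i Hi; lia]).
  + exact Hk.
  + now apply fib_bounded_isolated.
(* Decoding has to start at a 0; the tail from there is the image of a word that is again
   bounded. *)
- assert (exists p, x p = false) as [p Hp].
  { destruct (IH x false H) as [k [Hk _]]; now exists k. }
  pose proof (fib_bounded_shift p x H) as Hs.
  assert (E := theta_desubst (shift p x)).
  unfold shift at 1 in E; rewrite Nat.add_0_r in E.
  specialize (E Hp (fib_bounded_isolated _ Hs)).
  set (y := desubst (shift p x)) in *.
  rewrite <- E in Hs; apply fib_bounded_theta in Hs.
  destruct (IH y (negb b) Hs) as [j [Hj A]].
  apply theta_agree in A; rewrite theta_fib in A.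
  destruct (theta_block j y) as [k B].
  rewrite E, shift_shift, (scons_shift j), Hj in B.
  destruct b; simpl in B.
  + rewrite theta_false in B.
    exists (p + k + 1)%nat; split.
    * exact (f_equal (fun z => z 1%nat) B).
    * replace (S (p + k + 1)) with ((p + k) + 2)%nat by lia.
      now rewrite <- shift_shift, B.
  + rewrite theta_true in B.
    exists (p + k)%nat; split.
    * rewrite <- (Nat.add_0_r (p + k)); exact (f_equal (fun z => z 0%nat) B).
    * replace (S (p + k)) with ((p + k) + 1)%nat by lia.
      now rewrite <- shift_shift, B.
Qed.

(** * Values of sequences *)

Definition value (beta : R) (u : nat -> R) : R :=
  Series (fun k => u k / beta ^ S k).

Definition digits_le (M : R) (u : nat -> R) : Prop := forall k, 0 <= u k <= M.

Lemma digits_le_shift M k u : digits_le M u -> digits_le M (shift k u).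
Proof. intros H j; apply H. Qed.

Lemma is_series_const beta M :
  1 < beta -> is_series (fun k => M / beta ^ S k) (M / (beta - 1)).
Proof.
intro Hb.
assert (Hq : Rabs (/ beta) < 1).
{ rewrite Rabs_pos_eq.
  - rewrite <- Rinv_1; apply Rinv_lt_contravar; lra.
  - left; apply Rinv_0_lt_compat; lra. }
apply is_series_ext with (fun k => scal (M / beta) ((/ beta) ^ k)).
{ intro k; unfold scal; simpl; unfold mult; simpl.
  rewrite pow_inv; field; split; [apply pow_nonzero|]; lra. }
replace (M / (beta - 1)) with (scal (M / beta) (/ (1 - / beta))).
- apply @is_series_scal, is_series_geom, Hq.
- unfold scal; simpl; unfold mult; simpl; field; lra.
Qed.

Lemma value_const beta M : 1 < beta -> value beta (fun _ => M) = M / (beta - 1).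
Proof. intro H; apply is_series_unique, is_series_const, H. Qed.

Lemma div_pow_le beta a b k :
  1 < beta -> a <= b -> a / beta ^ S k <= b / beta ^ S k.
Proof.
intros Hb H; apply Rmult_le_compat_r; [|exact H].
left; apply Rinv_0_lt_compat, pow_lt; lra.
Qed.

Lemma ex_value beta M u :
  1 < beta -> digits_le M u -> ex_series (fun k => u k / beta ^ S k).
Proof.
intros Hb H.
apply @ex_series_le with (fun k => M / beta ^ S k).
- intro k; unfold norm; simpl; unfold abs; simpl.
  rewrite Rabs_pos_eq.
  + apply div_pow_le; [exact Hb | apply H].
  + replace 0 with (0 / beta ^ S k) by (unfold Rdiv; ring).
    apply div_pow_le; [exact Hb | apply H].
- eexists; now apply is_series_const.
Qed.

Lemma value_mono beta M u v :
  1 < beta -> digits_le M v -> (forall k, 0 <= u k <= v k) ->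
  value beta u <= value beta v.
Proof.
intros Hb Hv H; apply Series_le; [|now apply ex_value with M].
intro k; split.
- replace 0 with (0 / beta ^ S k) by (unfold Rdiv; ring).
  apply div_pow_le; [exact Hb | apply H].
- apply div_pow_le; [exact Hb | apply H].
Qed.

Lemma value_bounds beta M u :
  1 < beta -> digits_le M u -> 0 <= value beta u <= M / (beta - 1).
Proof.
intros Hb H; split.
- replace 0 with (value beta (fun _ => 0)).
  + apply value_mono with M; auto; intro k; split; [lra | apply H].
  + rewrite value_const by exact Hb; unfold Rdiv; ring.
- rewrite <- value_const by exact Hb.
  apply value_mono with M; auto.
  intro k; split; [|lra]; apply Rle_trans with (u k); apply H.
Qed.

Lemma value_head beta M u :
  1 < beta -> digits_le M u ->
  beta * value beta u = u 0%nat + value beta (shift 1 u).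
Proof.
intros Hb H; unfold value.
rewrite Series_incr_1 by now apply ex_value with M.
replace (Series (fun k => shift 1 u k / beta ^ S k))
  with (Series (fun k => beta * (u (S k) / beta ^ S (S k)))).
- rewrite Series_scal_l; simpl; field; lra.
- apply Series_ext; intro k; unfold shift; simpl; field.
  split; [apply pow_nonzero|]; lra.
Qed.

Lemma value_shift beta M u k :
  1 < beta -> digits_le M u ->
  beta * value beta (shift k u) = u k + value beta (shift (S k) u).
Proof.
intros Hb H.
rewrite (value_head beta M) by (auto using digits_le_shift).
rewrite shift_shift, Nat.add_1_r; unfold shift at 1; now rewrite Nat.add_0_r.
Qed.

Lemma value_antitone beta beta' M u :
  1 < beta <= beta' -> digits_le M u -> value beta' u <= value beta u.
Proof.
intros Hb H; apply Series_le; [|apply ex_value with M; auto; lra].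
intro k; split.
- apply Rmult_le_pos; [apply H|].
  left; apply Rinv_0_lt_compat, pow_lt; lra.
- apply Rmult_le_compat_l; [apply H|].
  apply Rinv_le_contravar; [apply pow_lt; lra | apply pow_incr; lra].
Qed.

Lemma value_complement beta M u :
  1 < beta -> digits_le M u ->
  value beta (fun k => M - u k) = M / (beta - 1) - value beta u.
Proof.
intros Hb H; rewrite <- value_const by exact Hb; unfold value.
rewrite <- Series_minus.
- apply Series_ext; intro k; unfold Rdiv; ring.
- apply (ex_value beta (Rmax 0 M)); [exact Hb|].
  intro k; split; [|apply Rmax_r]; apply Rle_trans with (u k); apply H.
- now apply ex_value with M.
Qed.

Lemma value_cancel beta M n u v :
  1 < beta -> digits_le M u -> digits_le M v -> agree n u v ->
  value beta u = value beta v <->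
  value beta (shift n u) = value beta (shift n v).
Proof.
intros Hb Hu Hv; induction n as [|n IH]; intro H; [reflexivity|].
rewrite IH by (intros i Hi; apply H; lia).
assert (Eu := value_shift beta M u n Hb Hu).
assert (Ev := value_shift beta M v n Hb Hv).
rewrite (H n) in Eu by lia.
split; intro E.
- rewrite E in Eu; lra.
- apply Rmult_eq_reg_l with beta; lra.
Qed.

Lemma value_agree beta M n u v :
  1 < beta -> digits_le M u -> digits_le M v -> agree n u v ->
  value beta u <= value beta v + M / (beta - 1) * (/ beta) ^ n.
Proof.
intros Hb; revert u v; induction n as [|n IH]; intros u v Hu Hv H; simpl.
- destruct (value_bounds beta M u Hb Hu), (value_bounds beta M v Hb Hv); lra.
- assert (Eu := value_head beta M u Hb Hu).
  assert (Ev := value_head beta M v Hb Hv).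
  rewrite (H 0%nat) in Eu by lia.
  assert (IHn : value beta (shift 1 u) <=
            value beta (shift 1 v) + M / (beta - 1) * (/ beta) ^ n).
  { apply IH; try (now apply digits_le_shift).
    intros i Hi; apply (H (S i)); lia. }
  apply Rmult_le_reg_l with beta; [lra|].
  rewrite Rmult_plus_distr_l, Ev, Eu.
  replace (beta * (M / (beta - 1) * (/ beta * (/ beta) ^ n)))
    with (M / (beta - 1) * (/ beta) ^ n) by (field; lra).
  lra.
Qed.

Lemma geometric_lt beta c e :
  1 < beta -> 0 < c -> 0 < e -> exists n, c * (/ beta) ^ n < e.
Proof.
intros Hb Hc He.
assert (Hq : 0 < / beta < 1).
{ split; [apply Rinv_0_lt_compat; lra|].
  rewrite <- Rinv_1; apply Rinv_lt_contravar; lra. }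
destruct (pow_lt_1_zero (/ beta)) with (y := e / c) as [n Hn].
{ rewrite Rabs_pos_eq; lra. }
{ now apply Rdiv_lt_0_compat. }
exists n; specialize (Hn n (le_n n)).
rewrite Rabs_pos_eq in Hn by (apply pow_le; lra).
apply (Rmult_lt_compat_l c) in Hn; [|exact Hc].
replace (c * (e / c)) with e in Hn by (field; lra).
exact Hn.
Qed.

(** * Values of 0-1 words *)

Definition word (x : nat -> bool) : nat -> R :=
  fun k => if x k then 1 else 0.

Lemma word_digits M x : 1 <= M -> digits_le M (word x).
Proof. intros H k; unfold word; destruct (x k); lra. Qed.

Lemma value_word beta a x :
  1 < beta ->
  beta * value beta (word (scons a x)) =
  (if a then 1 else 0) + value beta (word x).
Proof.
intro Hb; rewrite (value_head beta 1) by (auto; apply word_digits; lra).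
reflexivity.
Qed.

(** For [beta > 2] all later digits together are worth at most [1 / (beta - 1) < 1], less than the 1
    gained at the first difference. *)
Lemma value_lexlt beta x y :
  2 < beta -> lexlt x y -> value beta (word x) < value beta (word y).
Proof.
intros Hb [n H]; revert x y H.
induction n as [|n IH]; intros x y [H [Hx Hy]];
  apply Rmult_lt_reg_l with beta; try lra;
  rewrite <- (shift0 x), <- (shift0 y), (scons_shift 0 x), (scons_shift 0 y),
    !value_word by lra.
- rewrite Hx, Hy.
  destruct (value_bounds beta 1 (word (shift 1 x))); [lra | apply word_digits; lra |].
  destruct (value_bounds beta 1 (word (shift 1 y))); [lra | apply word_digits; lra |].
  assert (1 / (beta - 1) < 1); [|lra].
  apply Rlt_div_l; [lra | nra].
- rewrite (H 0%nat) by lia.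
  apply Rplus_lt_compat_l, IH; repeat split; auto.
  intros i Hi; apply (H (S i)); lia.
Qed.

(** * Unique expansions over {0, 1, m} *)

Section Ternary.

Variables (m beta : R).
Hypothesis Hm : 1 < m <= 2.
Hypothesis Hb : 1 < beta.

Lemma seq_over_digits u : seq_over [0; 1; m] u -> digits_le m u.
Proof. intros H k; destruct (H k) as [E|[E|[E|[]]]]; rewrite <- E; lra. Qed.

Lemma is_expansion_iff u x :
  is_expansion beta [0; 1; m] u x <-> seq_over [0; 1; m] u /\ value beta u = x.
Proof.
split; intros [H E]; split; auto.
- now apply is_series_unique.
- rewrite <- E; apply Series_correct.
  apply ex_value with m; auto using seq_over_digits.
Qed.

Lemma in_U_iff u :
  in_U beta [0; 1; m] u <->
  seq_over [0; 1; m] u /\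
  forall v, seq_over [0; 1; m] v -> value beta v = value beta u -> v = u.
Proof.
split.
- intros [x [E H]]; apply is_expansion_iff in E; destruct E as [Hu E].
  split; [exact Hu|]; intros v Hv Ev; apply H, is_expansion_iff.
  split; [exact Hv | congruence].
- intros [Hu H]; exists (value beta u); split.
  + now apply is_expansion_iff.
  + intros v Ev; apply is_expansion_iff in Ev; now apply H.
Qed.

(** No digit of [u] can be exchanged with a neighbouring digit, whatever
    follows. *)
Definition rigid (u : nat -> R) : Prop :=
  forall n,
    (u n = 0 -> value beta (shift (S n) u) < 1) /\
    (u n = 1 -> m / (beta - 1) - 1 < value beta (shift (S n) u) < m - 1) /\
    (u n = m -> m / (beta - 1) - (m - 1) < value beta (shift (S n) u)).

(** At the first index where [v] differs from [u], digit plus tail agree. As the tail of [v] lies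
    between 0 and [m / (beta - 1)], any exchange of digits there breaks an inequality of [rigid]. *)
Lemma rigid_in_U u :
  seq_over [0; 1; m] u -> rigid u -> in_U beta [0; 1; m] u.
Proof.
intros Hu H; apply in_U_iff; split; [exact Hu|]; intros v Hv E.
pose proof (seq_over_digits u Hu) as Du.
pose proof (seq_over_digits v Hv) as Dv.
extensionality n; revert n.
apply (well_founded_ind Nat.lt_wf_0 (fun n => v n = u n)); intros n IH.
apply (value_cancel beta m n v u) in E; auto.
assert (Eu := value_shift beta m u n Hb Du).
assert (Ev := value_shift beta m v n Hb Dv).
rewrite E in Ev.
assert (Bv := value_bounds beta m (shift (S n) v) Hb (digits_le_shift _ _ _ Dv)).
destruct (H n) as [H0 [H1 H2]].
destruct (Hu n) as [U|[U|[U|[]]]], (Hv n) as [V|[V|[V|[]]]];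
  rewrite <- U in *; rewrite <- V in *; try reflexivity;
  try (specialize (H0 eq_refl)); try (specialize (H1 eq_refl));
  try (specialize (H2 eq_refl)); lra.
Qed.

Lemma const0_in_U : in_U beta [0; 1; m] (const_seq 0).
Proof.
apply rigid_in_U; [intro k; simpl; auto|].
intro n; unfold shift, const_seq; rewrite value_const by exact Hb.
split; [|split]; intro E; repeat split; unfold Rdiv; lra.
Qed.

Lemma constm_in_U : in_U beta [0; 1; m] (const_seq m).
Proof.
apply rigid_in_U; [intro k; simpl; auto|].
intro n; unfold shift, const_seq; rewrite value_const by exact Hb.
split; [|split]; intro E; repeat split; lra.
Qed.

(** * Necessity of rigidity when [beta <= 1 + m] *)

Section Small.

Hypothesis Hbm : beta <= 1 + m.

(** The gaps between digits are at most 1, as [m <= 2], and [beta <= 1 + m] makes the interval at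
    least that long, so some digit keeps the remainder inside. The informative form lets the choice
    be iterated. *)
Lemma digit_step y :
  0 <= y <= m / (beta - 1) ->
  {d | In d [0; 1; m] /\ 0 <= beta * y - d <= m / (beta - 1)}.
Proof.
intro Hy.
assert (E : beta * (m / (beta - 1)) - m = m / (beta - 1)) by (field; lra).
assert (B : beta * y <= beta * (m / (beta - 1))) by (apply Rmult_le_compat_l; lra).
assert (B0 : 0 <= beta * y) by (apply Rmult_le_pos; lra).
assert (1 <= m / (beta - 1)).
{ apply Rle_div_r; [lra | nra]. }
destruct (Rle_dec (beta * y) (m / (beta - 1))).
{ exists 0; simpl; split; [auto | lra]. }
destruct (Rle_dec (beta * y) (1 + m / (beta - 1))).
{ exists 1; simpl; split; [auto | lra]. }
exists m; simpl; split; [auto | lra].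
Qed.

Lemma expansion_exists y :
  0 <= y <= m / (beta - 1) ->
  exists w, seq_over [0; 1; m] w /\ value beta w = y.
Proof.
intro Hy.
set (I := {r : R | 0 <= r <= m / (beta - 1)}).
assert (D : forall r : I, {d | In d [0; 1; m] /\
                             0 <= beta * proj1_sig r - d <= m / (beta - 1)}).
{ intros [r Hr]; now apply digit_step. }
set (next := fun r : I => exist (fun r => 0 <= r <= m / (beta - 1))
               (beta * proj1_sig r - proj1_sig (D r)) (proj2 (proj2_sig (D r))) : I).
set (r := fun n => Nat.iter n next (exist _ y Hy : I)).
set (w := fun n => proj1_sig (D (r n))).
assert (Hw : seq_over [0; 1; m] w).
{ intro k; exact (proj1 (proj2_sig (D (r k)))). }
exists w; split; [exact Hw|].
pose proof (seq_over_digits w Hw) as Dw.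
(* Remainder and tail value lie in the same bounded interval, so the right side tends to 0. *)
assert (Rem : forall n, y - value beta w =
          (proj1_sig (r n) - value beta (shift n w)) * (/ beta) ^ n).
{ induction n as [|n IH]; [simpl; rewrite shift0; lra|].
  assert (Er : proj1_sig (r (S n)) = beta * proj1_sig (r n) - w n) by reflexivity.
  assert (E := value_shift beta m w n Hb Dw).
  rewrite IH, Er; simpl.
  replace (value beta (shift (S n) w)) with (beta * value beta (shift n w) - w n)
    by lra.
  field; lra. }
apply NNPP; intro Hne.
set (e := Rabs (y - value beta w)).
assert (He : 0 < e) by (apply Rabs_pos_lt; lra).
assert (HM : 0 < m / (beta - 1)) by (apply Rdiv_lt_0_compat; lra).
destruct (geometric_lt beta _ e Hb HM He) as [N HN].
assert (Hp : 0 < (/ beta) ^ N) by (apply pow_lt, Rinv_0_lt_compat; lra).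
assert (Bound : e <= m / (beta - 1) * (/ beta) ^ N).
{ unfold e; rewrite (Rem N), Rabs_mult, (Rabs_pos_eq ((/ beta) ^ N)) by lra.
  apply Rmult_le_compat_r; [lra|].
  assert (B := value_bounds beta m (shift N w) Hb (digits_le_shift _ _ _ Dw)).
  assert (B' := proj2_sig (r N)); simpl in B'.
  apply Rabs_le; lra. }
lra.
Qed.

(** Otherwise an expansion of the remaining value, spliced in after [d], would give a second
    expansion. *)
Lemma in_U_no_exchange u n d :
  in_U beta [0; 1; m] u -> In d [0; 1; m] -> d <> u n ->
  ~ 0 <= u n + value beta (shift (S n) u) - d <= m / (beta - 1).
Proof.
intros HU Hd Hne Hy; apply in_U_iff in HU; destruct HU as [Hu H].
destruct (expansion_exists _ Hy) as [w [Hw Ew]].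
set (v := fun k => if lt_dec k n then u k
                   else if Nat.eq_dec k n then d else w (k - S n)%nat).
assert (Hv : seq_over [0; 1; m] v).
{ intro k; unfold v; destruct (lt_dec k n); [apply Hu|].
  destruct (Nat.eq_dec k n); [exact Hd | apply Hw]. }
assert (Vn : v n = d).
{ unfold v; destruct (lt_dec n n); [lia|].
  destruct (Nat.eq_dec n n); [reflexivity | lia]. }
assert (Vs : shift (S n) v = w).
{ extensionality k; unfold shift, v.
  destruct (lt_dec (S n + k) n); [lia|].
  destruct (Nat.eq_dec (S n + k) n); [lia|].
  f_equal; lia. }
apply Hne; rewrite <- Vn; apply (f_equal (fun z => z n)).
apply H; [exact Hv|].
pose proof (seq_over_digits u Hu) as Du.
pose proof (seq_over_digits v Hv) as Dv.
apply (value_cancel beta m n v u); auto.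
{ intros i Hi; unfold v; destruct (lt_dec i n); [reflexivity | lia]. }
apply Rmult_eq_reg_l with beta; [|lra].
rewrite (value_shift beta m u n), (value_shift beta m v n), Vn, Vs, Ew by auto.
ring.
Qed.

(** A failing inequality permits an exchange with an adjacent digit; the other end of the range is
    automatic. *)
Lemma in_U_rigid u : in_U beta [0; 1; m] u -> rigid u.
Proof.
intros HU n.
assert (Hu : seq_over [0; 1; m] u) by (apply in_U_iff in HU; apply HU).
assert (B := value_bounds beta m (shift (S n) u) Hb
               (digits_le_shift _ _ _ (seq_over_digits u Hu))).
assert (E := fun d => in_U_no_exchange u n d HU).
split; [|split]; intro U; repeat split; apply Rnot_le_lt; intro L.
- apply (E 1); [simpl; auto | lra | lra].
- apply (E 0); [simpl; auto | lra | lra].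
- apply (E m); [simpl; auto | lra | lra].
- apply (E 1); [simpl; auto | lra | lra].
Qed.

End Small.

Lemma critical_bound : beta <= 1 + sqrt m -> beta - 1 <= m / (beta - 1).
Proof.
intro Hs.
assert (Sq : sqrt m * sqrt m = m) by (apply sqrt_sqrt; lra).
apply Rle_div_r; [lra | nra].
Qed.

(** The tail after a digit [m] exceeds [m / (beta - 1) - (m - 1)], hence
    the tail [m...] is at least 1; but tails after 0 or 1 are below 1. *)
Lemma rigid_no_m_after u n :
  beta <= 1 + sqrt m -> seq_over [0; 1; m] u -> rigid u ->
  u n <> m -> u (S n) <> m.
Proof.
intros Hs Hu H Hn E.
destruct (H (S n)) as [_ [_ H2]]; specialize (H2 E).
assert (V := value_shift beta m u (S n) Hb (seq_over_digits u Hu)).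
rewrite E in V.
assert (L : value beta (shift (S n) u) < 1).
{ destruct (H n) as [H0 [H1 _]], (Hu n) as [U|[U|[U|[]]]];
    [apply H0; auto | | congruence].
  specialize (H1 (eq_sym U)); lra. }
(* By [H2] and [V], [beta] times the tail from [S n] on exceeds [1 + m / (beta - 1)], which is at
   least [beta]. *)
assert (K := critical_bound Hs).
nra.
Qed.

(** Once a digit differs from [m], no [m] returns. Without a digit 1 the sequence would be constant
    or a block of [m] followed by 0s, and the last [m] of such a block violates rigidity. *)
Lemma rigid_reaches_one u :
  beta <= 1 + sqrt m -> seq_over [0; 1; m] u -> rigid u ->
  u <> const_seq 0 -> u <> const_seq m ->
  exists k, u k = 1 /\ forall j, (k <= j)%nat -> u j = 0 \/ u j = 1.
Proof.
intros Hs Hu H N0 Nm.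
assert (Stay : forall i j, (i <= j)%nat -> u i <> m -> u j <> m).
{ intros i j Hij Hi; induction Hij; [exact Hi|].
  now apply rigid_no_m_after. }
destruct (classic (exists k, u k = 1)) as [[k Hk]|No1].
{ exists k; split; [exact Hk|]; intros j Hj.
  destruct (Hu j) as [U|[U|[U|[]]]]; auto.
  exfalso; apply (Stay k j Hj); lra. }
exfalso.
assert (Zero : forall j, u j <> m -> u j = 0).
{ intros j Hj; destruct (Hu j) as [U|[U|[U|[]]]]; auto; try congruence.
  exfalso; apply No1; now exists j. }
assert (U0 : u 0%nat = m).
{ apply NNPP; intro U0; apply N0; extensionality j.
  apply Zero, (Stay 0%nat); [lia | exact U0]. }
apply Nm; extensionality j; unfold const_seq.
induction j as [|j IH]; [exact U0|].
apply NNPP; intro Uj.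
destruct (H j) as [_ [_ H2]]; specialize (H2 IH).
assert (E : shift (S j) u = fun _ => 0).
{ extensionality i; apply Zero, (Stay (S j)); [lia | exact Uj]. }
rewrite E, value_const in H2 by exact Hb.
assert (Sq : sqrt m * sqrt m = m) by (apply sqrt_sqrt; lra).
assert (0 <= sqrt m) by apply sqrt_pos.
assert (K1 : 1 < m / (beta - 1)).
{ apply Rlt_div_r; [lra | nra]. }
unfold Rdiv in H2; lra.
Qed.

End Ternary.

(** * The critical base *)

Lemma value_PSeries x u : x <> 0 -> value (/ x) u = x * PSeries u x.
Proof.
intro Hx; unfold value, PSeries; rewrite <- Series_scal_l.
apply Series_ext; intro k; rewrite pow_inv; simpl; field.
split; [apply pow_nonzero|]; exact Hx.
Qed.

Lemma PSeries_digits_continuity M u x :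
  digits_le M u -> Rabs x < 1 -> continuity_pt (PSeries u) x.
Proof.
intros H Hx; apply PSeries_continuity.
apply Rbar_lt_le_trans with (Finite 1); [exact Hx|].
apply (proj1 (CV_radius_bounded u)); exists M; intro n.
rewrite pow1, Rmult_1_r, Rabs_pos_eq; apply H.
Qed.

Lemma value_fib_twice beta :
  1 < beta ->
  beta * (beta * value beta (word fib)) = 1 + value beta (word (shift 2 fib)).
Proof.
intro Hb.
assert (D : digits_le 1 (word fib)) by (apply word_digits; lra).
assert (E0 := value_shift beta 1 (word fib) 0 Hb D).
assert (E1 := value_shift beta 1 (word fib) 1 Hb D).
rewrite shift0 in E0; rewrite E0, Rmult_plus_distr_l, E1.
change (word fib 0%nat) with 0; change (word fib 1%nat) with 1.
change (shift 2 (word fib)) with (word (shift 2 fib)); ring.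
Qed.

Lemma value_fib_pos beta : 1 < beta -> 0 < value beta (word fib).
Proof.
intro Hb; pose proof (value_fib_twice beta Hb).
destruct (value_bounds beta 1 (word (shift 2 fib)) Hb); [apply word_digits; lra|].
apply Rmult_lt_reg_l with beta; [lra|].
apply Rmult_lt_reg_l with beta; lra.
Qed.

(** After splitting off the initial 01, [beta * beta] times the value is 1 plus an antitone term;
    positivity of the value then makes the decrease strict. *)
Lemma value_fib_decreasing beta beta' :
  1 < beta < beta' -> value beta' (word fib) < value beta (word fib).
Proof.
intro Hb.
assert (E := value_fib_twice beta ltac:(lra)).
assert (E' := value_fib_twice beta' ltac:(lra)).
assert (A : value beta' (word (shift 2 fib)) <= value beta (word (shift 2 fib))).
{ apply value_antitone with 1; [lra | apply word_digits; lra]. }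
pose proof (value_fib_pos beta' ltac:(lra)).
assert (beta * beta < beta' * beta') by nra.
apply Rmult_lt_reg_l with (beta * beta); nra.
Qed.

Lemma fib_nonconst a : word fib <> const_seq a.
Proof.
intro E.
assert (E0 := f_equal (fun z => z 0%nat) E).
assert (E1 := f_equal (fun z => z 1%nat) E).
change (0 = a) in E0; change (1 = a) in E1; lra.
Qed.

(** Intermediate values in [x = / beta]. At base 2 the right side is 0; at 12/5 it is 24/25, above
    the crude bound 5/7 on the value. The end 12/5 also ensures
    [(P - 1) * (P - 1) <= 49 / 25 < 2]. *)
Lemma critical_base_exists :
  exists P, 2 < P <= 12 / 5 /\ value P (word fib) = P * (P - 2).
Proof.
set (g := fun x => x * PSeries (word fib) x - / x * (/ x - 2)).
assert (D : digits_le 1 (word fib)) by (apply word_digits; lra).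
destruct (IVT_interv g (5 / 12) (1 / 2)) as [x [Hx Gx]].
- intros x Hx.
  apply continuity_pt_minus; apply continuity_pt_mult.
  + apply derivable_continuous_pt, derivable_pt_id.
  + apply PSeries_digits_continuity with 1; [exact D|].
    rewrite Rabs_pos_eq; lra.
  + apply continuity_pt_inv; [apply derivable_continuous_pt, derivable_pt_id | lra].
  + apply continuity_pt_minus.
    * apply continuity_pt_inv; [apply derivable_continuous_pt, derivable_pt_id | lra].
    * apply continuity_pt_const; intros ? ?; reflexivity.
- lra.
- unfold g; rewrite <- value_PSeries by lra.
  replace (/ (5 / 12)) with (12 / 5) by field.
  destruct (value_bounds (12 / 5) 1 (word fib)); [lra | exact D |].
  lra.
- unfold g; rewrite <- value_PSeries by lra.
  replace (/ (1 / 2)) with 2 by field.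
  pose proof (value_fib_pos 2 ltac:(lra)); lra.
- unfold g in Gx; rewrite <- value_PSeries in Gx by lra.
  assert (H1 : / x <= 12 / 5).
  { replace (12 / 5) with (/ (5 / 12)) by field.
    apply Rinv_le_contravar; lra. }
  assert (H2 : 2 <= / x).
  { replace 2 with (/ (1 / 2)) by field.
    apply Rinv_le_contravar; lra. }
  pose proof (value_fib_pos (/ x) ltac:(lra)).
  exists (/ x); split; [|lra].
  split; [|exact H1].
  destruct H2 as [H2|H2]; [exact H2 | exfalso].
  rewrite <- H2 in *; lra.
Qed.

(** * The critical base [P] and the bases on either side *)

Section Critical.

Variables (P m : R).
Hypothesis HP : 2 < P <= 12 / 5.
Hypothesis Hfib : value P (word fib) = P * (P - 2).
Hypothesis Em : m = (P - 1) * (P - 1).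

Lemma m_range : 1 < m <= 2.
Proof. rewrite Em; nra. Qed.

Lemma sqrt_m : sqrt m = P - 1.
Proof. rewrite Em; apply sqrt_square; lra. Qed.

Lemma value_fib_critical : value P (word fib) = m - 1.
Proof. rewrite Hfib, Em; ring. Qed.

(** Complementing digits turns [m / (beta - 1)] minus the value of 0s into the value of one sequence
    with nonnegative digits. This is antitone in the base, so its comparison with 1 transfers from
    [P] to other bases. *)
Lemma complement_critical :
  value P (fun k => m - word (scons false fib) k) = 1.
Proof.
pose proof m_range.
rewrite value_complement by (try apply word_digits; lra).
assert (E := value_word P false fib ltac:(lra)); rewrite Hfib in E.
replace (value P (word (scons false fib))) with (P - 2).
- rewrite Em; field; lra.
- apply Rmult_eq_reg_l with P; lra.
Qed.

Lemma complement_digits : digits_le m (fun k => m - word (scons false fib) k).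
Proof.
intro k; pose proof m_range; unfold word; destruct (scons false fib k); lra.
Qed.

(** In base [P] the bounds after a digit 1 are the values of 0s and s; in larger bases these values
    stay within the bounds by monotonicity. Strictness comes from [fib_shift_bounds]. *)
Lemma fib_rigid beta : P <= beta -> rigid m beta (word fib).
Proof.
intros Hb n; pose proof m_range as Rm.
change (shift (S n) (word fib)) with (word (shift (S n) fib)).
destruct (fib_shift_bounds n) as [_ up].
destruct (fib_shift_bounds (S n)) as [lo _].
assert (V0 : value beta (word fib) <= m - 1).
{ rewrite <- value_fib_critical.
  apply value_antitone with 1; [lra | apply word_digits; lra]. }
assert (V1 : m / (beta - 1) - 1 <= value beta (word (scons false fib))).
{ assert (A := value_antitone P beta m _ ltac:(lra) complement_digits).
  rewrite complement_critical, value_complement in A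
    by (try apply word_digits; lra).
  lra. }
apply (value_lexlt beta) in lo; [|lra].
split; [|split]; intro U.
- destruct (value_bounds beta 1 (word (shift (S n) fib))) as [_ B];
    [lra | apply word_digits; lra |].
  apply Rle_lt_trans with (1 := B).
  apply Rlt_div_l; [lra | nra].
- split; [lra|].
  rewrite (scons_shift n) in up.
  unfold word in U; destruct (fib n); [|lra].
  apply lexlt_scons, (value_lexlt beta) in up; lra.
- exfalso; unfold word in U; destruct (fib n); lra.
Qed.

Lemma fib_over : seq_over [0; 1; m] (word fib).
Proof. intro k; unfold word; simpl; destruct (fib k); auto. Qed.

Lemma fib_in_U beta : P <= beta -> in_U beta [0; 1; m] (word fib).
Proof.
intro Hb; pose proof m_range.
apply rigid_in_U; [lra | lra | exact fib_over | now apply fib_rigid].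
Qed.

(** Below [P] the comparisons of 0s and s with the bounds after 1 are reversed, so [value_lexlt],
    contraposed, turns numerical bounds on tails into lexicographic ones. *)
Lemma fib_bounded_of_rigid beta x :
  2 < beta < P -> rigid m beta (word x) -> x 0%nat = true ->
  fib_bounded (shift 1 x).
Proof.
intros Hb H Hx; pose proof m_range as Rm.
assert (V0 := value_fib_decreasing beta P ltac:(lra)).
rewrite value_fib_critical in V0.
assert (V1 : value beta (word (scons false fib)) <= m / (beta - 1) - 1).
{ assert (A := value_antitone beta P m _ ltac:(lra) complement_digits).
  rewrite complement_critical, value_complement in A
    by (try apply word_digits; lra).
  lra. }
assert (Step : forall j, x j = true ->
    m / (beta - 1) - 1 < value beta (word (shift (S j) x)) < m - 1).
{ intros j Hj; destruct (H j) as [_ [H1 _]]; apply H1.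
  unfold word; now rewrite Hj. }
(* Rigidity bounds tails from below only after a 1; after a 0 the value of the tail is [beta] times
   that of the preceding tail, so the bound persists. *)
assert (Low : forall j,
    value beta (word (scons false fib)) <= value beta (word (shift (S j) x))).
{ induction j as [|j IH]; [specialize (Step 0%nat Hx); lra|].
  destruct (x (S j)) eqn:Hj; [specialize (Step (S j) Hj); lra|].
  rewrite (scons_shift (S j)), Hj in IH.
  assert (E := value_word beta false (shift (S (S j)) x) ltac:(lra)).
  destruct (value_bounds beta 1 (word (scons false (shift (S (S j)) x))));
    [lra | apply word_digits; lra |].
  nra. }
intro j; rewrite shift_shift; simpl; split; intro L.
- apply (value_lexlt beta) in L; [|lra]; specialize (Low j); lra.
- rewrite (scons_shift (S j)) in L.
  destruct (x (S j)) eqn:Hj; [|now apply not_lexlt_true_false in L].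
  apply lexlt_scons, (value_lexlt beta) in L; [|lra].
  specialize (Step (S j) Hj); lra.
Qed.

(** Some 1 is followed by so long a prefix of s that the tail is worth nearly as much as s, hence
    more than the [m - 1] allowed there. *)
Lemma no_rigid_word beta x :
  2 < beta < P -> rigid m beta (word x) -> x 0%nat <> true.
Proof.
intros Hb H Hx; pose proof m_range as Rm.
assert (B := fib_bounded_of_rigid beta x Hb H Hx).
assert (V0 := value_fib_decreasing beta P ltac:(lra)).
rewrite value_fib_critical in V0.
set (e := value beta (word fib) - (m - 1)).
assert (He : 0 < e) by (unfold e; lra).
assert (HM : 0 < 1 / (beta - 1)) by (apply Rdiv_lt_0_compat; lra).
destruct (geometric_lt beta _ e ltac:(lra) HM He) as [N HN].
destruct (fib_bounded_prefix N _ true B) as [k [Hk A]].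
rewrite shift_shift in A.
destruct (H (1 + k)%nat) as [_ [H1 _]].
assert (T : word x (1 + k)%nat = 1).
{ unfold word; unfold shift in Hk; now rewrite Hk. }
specialize (H1 T).
assert (V : value beta (word fib) <=
    value beta (word (shift (1 + S k) x)) + 1 / (beta - 1) * (/ beta) ^ N).
{ apply value_agree; try (apply word_digits); try lra.
  intros i Hi; unfold word; now rewrite (A i Hi). }
replace (1 + S k)%nat with (S (1 + k)) in V by lia.
change (word (shift (S (1 + k)) x)) with (shift (S (1 + k)) (word x)) in V.
unfold e in HN; lra.
Qed.

Lemma in_U_trivial beta u :
  1 < beta < P -> in_U beta [0; 1; m] u -> u = const_seq 0 \/ u = const_seq m.
Proof.
intros Hb HU; pose proof m_range as Rm.
apply NNPP; intro N; apply not_or_and in N; destruct N as [N0 Nm].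
assert (Hu : seq_over [0; 1; m] u) by (apply in_U_iff in HU; [apply HU | lra..]).
assert (H : rigid m beta u).
{ apply in_U_rigid; auto; try lra; rewrite Em; nra. }
destruct (rigid_reaches_one m beta Rm ltac:(lra) u) as [k [Hk Tail]]; auto.
{ rewrite sqrt_m; lra. }
(* For [beta <= 2], out of reach of [value_lexlt], the two bounds after a digit 1 exclude each
   other. *)
destruct (Rle_dec beta 2) as [Hle|Hgt].
{ destruct (H k) as [_ [H1 _]]; specialize (H1 Hk).
  assert (m <= m / (beta - 1)); [|lra].
  apply Rle_div_r; [lra | nra]. }
set (x := fun j => if Req_EM_T (u (k + j)%nat) 1 then true else false).
assert (E : word x = shift k u).
{ extensionality j; unfold word, x, shift.
  destruct (Req_EM_T (u (k + j)%nat) 1) as [U|U]; [now rewrite U|].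
  destruct (Tail (k + j)%nat) as [U'|U']; [lia | now rewrite U' | congruence]. }
apply (no_rigid_word beta x); [lra | |].
- rewrite E; intro n; rewrite shift_shift, Nat.add_succ_r; apply H.
- unfold x; rewrite Nat.add_0_r; now destruct (Req_EM_T (u k) 1).
Qed.

Lemma critical_golden_ratio : is_golden_ratio [0; 1; m] P.
Proof.
pose proof m_range as Rm.
split; [lra|]; exists 0, m; repeat apply conj.
- simpl; auto.
- intros b [<-|[<-|[<-|[]]]]; lra.
- simpl; auto.
- intros b [<-|[<-|[<-|[]]]]; lra.
- intros beta Hb u; split; [now apply in_U_trivial|].
  intros [->| ->]; [apply const0_in_U | apply constm_in_U]; lra.
- intros beta Hb; exists (word fib).
  split; [apply fib_in_U; lra | split; apply fib_nonconst].
Qed.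

Lemma seq_over_scons a u :
  In a [0; 1; m] -> seq_over [0; 1; m] u -> seq_over [0; 1; m] (scons a u).
Proof. intros Ha Hu [|k]; [exact Ha | apply Hu]. Qed.

(** First digit 0, 1 or [m] leaves [m], [m - 1] or 0 for the tail: [m] exceeds the maximal value
    [m / (P - 1)], and the others are the values of s and 000..., each with a unique expansion in
    base [P]. *)
Lemma two_expansions w :
  is_expansion P [0; 1; m] w (m / P) <->
  w = scons 1 (word fib) \/ w = scons m (const_seq 0).
Proof.
pose proof m_range as Rm.
assert (HP1 : 1 < P) by lra.
assert (EmP : P * (m / P) = m) by (field; lra).
destruct (proj1 (in_U_iff m P Rm HP1 _) (fib_in_U P ltac:(lra))) as [Of Uf].
destruct (proj1 (in_U_iff m P Rm HP1 _) (const0_in_U m P Rm HP1)) as [O0 U0].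
assert (V0 : value P (const_seq 0) = 0).
{ unfold const_seq; rewrite value_const by lra; unfold Rdiv; ring. }
rewrite V0 in U0; rewrite value_fib_critical in Uf.
rewrite is_expansion_iff by lra; split.
- intros [Ow Vw].
  assert (E := value_shift P m w 0 HP1 (seq_over_digits m Rm w Ow)).
  rewrite shift0, Vw, EmP in E.
  assert (B := value_bounds P m (shift 1 w) HP1
                 (seq_over_digits m Rm _ (fun k => Ow (1 + k)%nat))).
  rewrite <- (shift0 w), (scons_shift 0 w).
  destruct (Ow 0%nat) as [W|[W|[W|[]]]]; rewrite <- W in *.
  + exfalso.
    assert (m / (P - 1) < m); [|lra].
    apply Rlt_div_l; [lra | nra].
  + left; f_equal; apply Uf; [intro k; apply Ow | lra].
  + right; f_equal; apply U0; [intro k; apply Ow | lra].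
- assert (key : forall a u, In a [0; 1; m] -> seq_over [0; 1; m] u ->
      a + value P u = m ->
      seq_over [0; 1; m] (scons a u) /\ value P (scons a u) = m / P).
  { intros a u Ha Hu E.
    pose proof (seq_over_scons a u Ha Hu) as O; split; [exact O|].
    assert (V := value_head P m _ HP1 (seq_over_digits m Rm _ O)).
    rewrite shift1_scons in V; simpl in V.
    apply Rmult_eq_reg_l with P; lra. }
  intros [->| ->]; apply key; simpl; auto.
  + rewrite value_fib_critical; ring.
  + rewrite V0; ring.
Qed.

End Critical.

Theorem theorem5 :
  exists m : R, 1 < m <= 2 /\
  exists beta : R, is_golden_ratio [0; 1; m] beta /\
    (exists u : nat -> R, in_U beta [0; 1; m] u /\
       u <> const_seq 0 /\ u <> const_seq m) /\
    (exists x : R, exists u v : nat -> R,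
       u <> v /\
       is_expansion beta [0; 1; m] u x /\
       is_expansion beta [0; 1; m] v x /\
       forall w : nat -> R, is_expansion beta [0; 1; m] w x -> w = u \/ w = v).
Proof.
destruct critical_base_exists as [P [HP Hfib]].
exists ((P - 1) * (P - 1)).
pose proof (m_range P _ HP eq_refl) as Rm.
split; [exact Rm|]; exists P.
split; [now apply critical_golden_ratio|]; split.
- exists (word fib).
  split; [apply (fib_in_U P _ HP Hfib eq_refl); lra | split; apply fib_nonconst].
- set (m := (P - 1) * (P - 1)) in *.
  exists (m / P), (scons 1 (word fib)), (scons m (const_seq 0)).
  assert (H := two_expansions P m HP Hfib eq_refl).
  split; [|split; [|split]].
  + intro E; apply (f_equal (fun z => z 0%nat)) in E; simpl in E; lra.
  + apply H; now left.
  + apply H; now right.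
  + intro w; apply H.
Qed.
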